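(* Let $\Phi$ be a measurable linear cocycle over $\theta$ with generator $A$, and suppose that $\Phi$ has a tempered exponential dichotomy on $\widetilde\Omega\subset\Omega$ with exponent $\alpha:\Omega\to(0,+\infty)$ and bound $K:\Omega\to(0,+\infty)$. Then for any $\theta$-invariant random variable $\beta:\Omega\to\mathbb R$ with $\beta(\omega)\in(-\alpha(\omega),\alpha(\omega))$ for $\omega\in\Omega$, the following hold: (i) The pair $(\ell^\infty_{1/K,\beta}(\widetilde\Omega\times\mathbb Z),\ell^\infty_{1,\beta}(\widetilde\Omega\times\mathbb Z))$ is measurably properly admissible for $\Phi$, and additionally there is a $\theta$-invariant positive random variable $\gamma:\Omega\to(0,+\infty)$ such that for $\omega\in\widetilde\Omega$ and $f\in\ell^\infty_{1/K(\omega),\beta(\omega)}(\mathbb Z)$, $$\|x\|_{\ell^\infty_{1,\beta(\omega)}(\mathbb Z)}\le\gamma(\omega)\,\|f\|_{\ell^\infty_{1/K(\omega),\beta(\omega)}(\mathbb Z)},$$ where $x\in\ell^\infty_{1,\beta(\omega)}(\mathbb Z)$ is the (unique) solution of $x(n+1)=A(\theta^n\omega)x(n)+f(n+1)$, $n\in\mathbb Z$. (ii) The pair $(\ell^\infty_{|1/K,\beta|}(\widetilde\Omega\times\mathbb Z),\ell^\infty_{|1,\beta|}(\widetilde\Omega\times\mathbb Z))$ is measurably properly admissible for $\Phi$, and additionally there is a $\theta$-invariant positive random variable $\widetilde\gamma:\Omega\to(0,+\infty)$ such that for $\omega\in\widetilde\Omega$ and $f\in\ell^\infty_{|1/K(\omega),\beta(\omega)|}(\mathbb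 Z)$, $$\|x\|_{\ell^\infty_{|1,\beta(\omega)|}(\mathbb Z)}\le\widetilde\gamma(\omega)\,\|f\|_{\ell^\infty_{|1/K(\omega),\beta(\omega)|}(\mathbb Z)},$$ where $x\in\ell^\infty_{|1,\beta(\omega)|}(\mathbb Z)$ is the (unique) solution of $x(n+1)=A(\theta^n\omega)x(n)+f(n+1)$, $n\in\mathbb Z$.
   Context: Notation. $X=(X,|\cdot|)$ is a separable Banach space; $\mathcal L(X)$ is the Banach space of bounded linear operators on $X$ with operator norm $\|\cdot\|$; $\mathcal R(P)$ is the range of $P$; $\mathbb Z_+$ (resp. $\mathbb Z_-$) is the set of nonnegative (resp. nonpositive) integers. $(\Omega,\mathcal F,\mathbb P)$ is a measure space and $\theta:\Omega\to\Omega$ is an invertible measurable transformation preserving $\mathbb P$, i.e. $\mathbb P(\theta^{-1}(E))=\mathbb P(E)$ for each $E\in\mathcal F$. A random variable is a measurable function; a function $g$ on $\Omega$ is $\theta$-invariant if $g(\theta\omega)=g(\omega)$ for all $\omega\in\Omega$. A set $\widetilde\Omega$ is $\theta$-invariant if $\theta(\widetilde\Omega)=\widetilde\Omega$; full measure means null complement. Cocycles. A measurable linear cocycle over $\theta$ is a map $\Phi:\mathbb Z_+\times\Omega\to\mathcal L(X)$ with $\Phi(0,\omega)=\mathrm{Id}$, $\Phi(n+m,\omega)=\Phi(m,\theta^n\omega)\Phi(n,\omega)$ for all $\omega\in\Omega$, $n,m\in\mathbb Z_+$, and such that $\omega\mapsto\Phi(n,\omega)$ is strongly measurable for each $n$ (i.e.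 $\omega\mapsto\Phi(n,\omega)x$ is measurable for each $x\in X$). Its generator is $A(\omega):=\Phi(1,\omega)$. A random variable $K:\Omega\to(0,+\infty)$ is tempered (with respect to $\theta$) if $\lim_{n\to\pm\infty}\frac{\ln K(\theta^n\omega)}{n}=0$ for $\mathbb P$-a.e. $\omega\in\Omega$. Tempered exponential dichotomy. $\Phi$ has a tempered exponential dichotomy on a $\theta$-invariant (measurable) subset $\widetilde\Omega\subset\Omega$ of full measure if there is a strongly measurable map $\Pi^s:\widetilde\Omega\to\mathcal L(X)$ such that, with $\Pi^u(\omega):=\mathrm{Id}-\Pi^s(\omega)$: (a) $\Pi^s(\omega)$ is a projection on $X$ for every $\omega\in\widetilde\Omega$; (b) $\Pi^s(\theta^n\omega)\Phi(n,\omega)=\Phi(n,\omega)\Pi^s(\omega)$ for all $\omega\in\widetilde\Omega$, $n\in\mathbb Z_+$; (c) $\Phi(n,\omega)|_{\mathcal R(\Pi^u(\omega))}$ is an isomorphism from $\mathcal R(\Pi^u(\omega))$ onto $\mathcal R(\Pi^u(\theta^n\omega))$ for all $\omega\in\widetilde\Omega$, $n\in\mathbb Z_+$, and $\omega\mapsto\Phi(n,\omega)\Pi^u(\omega)$ is strongly measurable for $n\in\mathbb Z_-$, where for $n\in\mathbb Z_-$, $\Phi(n,\omega):=(\Phi(-n,\theta^n\omega)|_{\mathcal R(\Pi^u(\theta^n\omega))})^{-1}$; (d) there are a $\theta$-invariant random variable $\alpha:\Omega\to(0,+\infty)$ (the exponent) and a tempered random variable $K:\Omega\to(0,+\infty)$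 (the bound) such that $\|\Phi(n,\omega)\Pi^s(\omega)\|\le K(\omega)e^{-\alpha(\omega)n}$ for $\omega\in\widetilde\Omega$, $n\in\mathbb Z_+$, and $\|\Phi(n,\omega)\Pi^u(\omega)\|\le K(\omega)e^{\alpha(\omega)n}$ for $\omega\in\widetilde\Omega$, $n\in\mathbb Z_-$. Sequence spaces. For random variables $K:\Omega\to(0,+\infty)$, $\beta:\Omega\to\mathbb R$ and $\omega\in\Omega$, $\ell^\infty_{1/K(\omega),\beta(\omega)}(\mathbb Z)$ is the Banach space of sequences $f=(f(n))_{n\in\mathbb Z}\subset X$ with finite norm $\sup_{n\in\mathbb Z}(K(\theta^n\omega)e^{-\beta(\omega)n}|f(n)|)$, and $\ell^\infty_{|1/K(\omega),\beta(\omega)|}(\mathbb Z)$ is the Banach space of those with finite norm $\sup_{n\in\mathbb Z}(K(\theta^n\omega)e^{-\beta(\omega)|n|}|f(n)|)$. When $K\equiv1$ they are written $\ell^\infty_{1,\beta(\omega)}(\mathbb Z)$ and $\ell^\infty_{|1,\beta(\omega)|}(\mathbb Z)$. For a $\theta$-invariant measurable $\widetilde\Omega\subset\Omega$, $\ell^\infty_{1/K,\beta}(\widetilde\Omega\times\mathbb Z)$ (resp. $\ell^\infty_{|1/K,\beta|}(\widetilde\Omega\times\mathbb Z)$) is the set of all $f:\widetilde\Omega\times\mathbb Z\to X$ with $f(\omega,\cdot)\in\ell^\infty_{1/K(\omega),\beta(\omega)}(\mathbb Z)$ (resp. $\ell^\infty_{|1/K(\omega),\beta(\omega)|}(\mathbb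 Z)$) for every $\omega\in\widetilde\Omega$; again $1$ replaces $1/K$ if $K\equiv1$. Admissibility. A pair $(\mathcal Y,\mathcal Z)$ of such classes of functions on $\widetilde\Omega\times\mathbb Z$ is properly admissible for $\Phi$ if for each $f\in\mathcal Y$ there is a unique $x\in\mathcal Z$ with $x(\omega,n+1)=A(\theta^n\omega)x(\omega,n)+f(\omega,n+1)$ for all $n\in\mathbb Z$, $\omega\in\widetilde\Omega$. It is measurably properly admissible if moreover, for each $f\in\mathcal Y$ such that $\omega\mapsto f(\omega,n)$ is measurable for each $n\in\mathbb Z$, the unique $x$ is such that $\omega\mapsto x(\omega,n)$ is measurable for each $n\in\mathbb Z$.
   Formalization: Both conclusions are proved on the set of ω in Ω̃ at which K is tempered (shown measurable, θ-invariant, of full measure) instead of on all of Ω̃, since uniqueness can fail on null orbits where K is not tempered; if K is tempered on all of Ω̃ the two sets agree. *)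

(* Defs.v *)
(* MathComp / MathComp-Analysis *)
From HB Require Import structures.
From mathcomp Require Import all_boot all_order all_algebra.
From mathcomp Require Import all_classical all_reals all_analysis.

Set Implicit Arguments.
Unset Strict Implicit.
Unset Printing Implicit Defensive.

Import Order.TTheory GRing.Theory Num.Theory.
Import numFieldNormedType.Exports.

Local Open Scope classical_set_scope.
Local Open Scope ring_scope.

Definition separable (T : topologicalType) : Prop :=
  exists2 S : set T, countable S & dense S.

Definition borel (T : ptopologicalType) := g_sigma_algebraType (@open T).

(* Valued in \bar R, so that an unbounded map has norm +oo instead of a junk
   real value. *)
Definition opnorm (R : realType) (X : normedModType R) (T : X -> X) : \bar R :=
  ereal_sup [set `|T x|%:E | x in [set x : X | `|x| <= 1]].

Section dynamics.
Context (R : realType) d (Omega : measurableType d).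
Context (P : {measure set Omega -> \bar R}) (th thi : Omega -> Omega).

(* [thi] is the inverse of [th]; an invertible measurable transformation is
   understood to be bimeasurable. *)
Record invertible_mpt : Prop := InvertibleMpt {
  mpt_K : cancel th thi;
  mpt_invK : cancel thi th;
  mpt_meas : measurable_fun setT th;
  mpt_inv_meas : measurable_fun setT thi;
  mpt_preserves : forall E, measurable E -> P (th @^-1` E) = P E }.

Definition iterZ (n : int) : Omega -> Omega :=
  match n with Posz m => iter m th | Negz m => iter m.+1 thi end.

Definition invariant_fun T (g : Omega -> T) : Prop :=
  forall w, g (th w) = g w.

Definition invariant_set (D : set Omega) : Prop := th @` D = D.

Definition full_measure (D : set Omega) : Prop := P (~` D) = 0%E.

Definition positive_rv (K : Omega -> R) : Prop :=
  measurable_fun setT K /\ forall w, 0 < K w.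

Definition tempered_at (K : Omega -> R) (w : Omega) : Prop :=
  (fun n : nat => ln (K (iterZ n%:Z w)) / (n%:Z)%:~R) @ \oo --> (0 : R) /\
  (fun n : nat => ln (K (iterZ (- n%:Z) w)) / (- n%:Z)%:~R) @ \oo --> (0 : R).

Definition tempered (K : Omega -> R) : Prop :=
  positive_rv K /\ {ae P, forall w, tempered_at K w}.

(* As K is tempered only almost everywhere, a set D of full measure carrying a
   dichotomy may contain null orbits along which K is not tempered, and along
   them a nonzero homogeneous solution can be bounded: uniqueness fails. The
   points of such orbits are removed here; what remains is still invariant,
   measurable and of full measure, and is D itself if K is tempered on D. *)
Definition tempered_part (D : set Omega) (K : Omega -> R) : set Omega :=
  D `&` [set w | tempered_at K w].

End dynamics.

Section cocycles.
Context (R : realType) (X : completeNormedModType R).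
Context d (Omega : measurableType d).
Context (P : {measure set Omega -> \bar R}) (th thi : Omega -> Omega).

Definition strongly_measurable (D : set Omega) (T : Omega -> X -> X) : Prop :=
  forall x : X, measurable_fun D (fun w => T w x : borel X).

(* Bounded linear operators are rendered as continuous {linear X -> X}. *)
Record measurable_cocycle (Phi : nat -> Omega -> {linear X -> X}) : Prop :=
  MeasurableCocycle {
  cocycle_continuous : forall n w, continuous (Phi n w);
  cocycle0 : forall w x, Phi 0%N w x = x;
  cocycleD : forall n m w x,
    Phi (n + m)%N w x = Phi m (iter n th w) (Phi n w x);
  cocycle_meas : forall n, strongly_measurable setT (Phi n) }.

Section dichotomy.
Context (Phi : nat -> Omega -> {linear X -> X}).
Context (Ps : Omega -> {linear X -> X}).

Definition compl_proj (w : Omega) (x : X) : X := x - Ps w x.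

(* The operator Phi(-m, w): the inverse of the restriction of
   Phi(m, th^-m w) to the range of the unstable projection at th^-m w. It is
   only meaningful on the image of that restriction. *)
Definition cocycle_inv (m : nat) (w : Omega) : X -> X :=
  let w' := iter m thi w in 'pinv_(fun=> 0) (range (compl_proj w')) (Phi m w').

Record dichotomy_with (D : set Omega) (alpha K : Omega -> R) : Prop :=
  DichotomyWith {
  dich_continuous : forall w, D w -> continuous (Ps w);
  dich_meas : strongly_measurable D Ps;
  dich_proj : forall w, D w -> forall x, Ps w (Ps w x) = Ps w x;
  dich_comm : forall w, D w -> forall n x,
    Ps (iter n th w) (Phi n w x) = Phi n w (Ps w x);
  dich_iso_bij : forall w, D w -> forall n,
    set_bij (range (compl_proj w)) (range (compl_proj (iter n th w))) (Phi n w);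
  dich_iso_continuous : forall w, D w -> forall n,
    {within range (compl_proj (iter n th w)),
      continuous ('pinv_(fun=> 0) (range (compl_proj w)) (Phi n w))};
  dich_inv_meas : forall m,
    strongly_measurable D (fun w => cocycle_inv m w \o compl_proj w);
  dich_exponent : positive_rv alpha /\ invariant_fun th alpha;
  dich_bound : tempered P th thi K;
  dich_stable : forall w, D w -> forall n : nat,
    (opnorm (Phi n w \o Ps w) <= (K w * expR (- (alpha w * n%:R)))%:E)%E;
  dich_unstable : forall w, D w -> forall m : nat,
    (opnorm (cocycle_inv m w \o compl_proj w)
       <= (K w * expR (alpha w * - m%:R))%:E)%E }.

End dichotomy.

Definition tempered_dichotomy (Phi : nat -> Omega -> {linear X -> X})
    (D : set Omega) (alpha K : Omega -> R) : Prop :=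
  [/\ measurable D, invariant_set th D, full_measure P D &
      exists Ps : Omega -> {linear X -> X}, dichotomy_with Phi Ps D alpha K].

Definition weight (K beta : Omega -> R) (w : Omega) (n : int) : R :=
  K (iterZ th thi n w) * expR (- (beta w * n%:~R)).

Definition weight_abs (K beta : Omega -> R) (w : Omega) (n : int) : R :=
  K (iterZ th thi n w) * expR (- (beta w * `|n|%:~R)).

Definition wnorm (W : int -> R) (f : int -> X) : \bar R :=
  ereal_sup [set (W n * `|f n|)%:E | n in [set: int]].

Definition linf (W : int -> R) : set (int -> X) :=
  [set f | (wnorm W f < +oo)%E].

(* A function on D x Z is represented by a function on Omega x Z of which only
   the values over D matter; accordingly, uniqueness below is up to equality
   over D. *)
Definition linf_on (D : set Omega) (W : Omega -> int -> R) :
    set (Omega -> int -> X) :=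
  [set f | forall w, D w -> linf (W w) (f w)].

Definition solution (A : Omega -> X -> X) (w : Omega) (f x : int -> X) : Prop :=
  forall n : int, x (n + 1) = A (iterZ th thi n w) (x n) + f (n + 1).

Definition solution_on (A : Omega -> X -> X) (D : set Omega)
    (f x : Omega -> int -> X) : Prop :=
  forall w, D w -> solution A w (f w) (x w).

Definition properly_admissible (A : Omega -> X -> X) (D : set Omega)
    (Y Z : set (Omega -> int -> X)) : Prop :=
  forall f, Y f -> exists x, [/\ Z x, solution_on A D f x &
    forall y, Z y -> solution_on A D f y -> forall w, D w -> y w = x w].

Definition measurable_sections (D : set Omega) (f : Omega -> int -> X) : Prop :=
  forall n, measurable_fun D (fun w => f w n : borel X).

Definition measurably_properly_admissible (A : Omega -> X -> X) (D : set Omega)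
    (Y Z : set (Omega -> int -> X)) : Prop :=
  properly_admissible A D Y Z /\
  forall f x, Y f -> measurable_sections D f -> Z x -> solution_on A D f x ->
    measurable_sections D x.

End cocycles.

(* Main.v *)
Require Import Defs.
From HB Require Import structures.
From mathcomp Require Import all_boot all_order all_algebra.
From mathcomp Require Import all_classical all_reals all_analysis.
From mathcomp Require Import measurable_realfun.
From mathcomp Require Import zify ring lra.

(** Along one orbit a dichotomy is a Green function.  Write S(j, w) for
    Phi(j, w) Ps(w) and U(j, w) for Phi(-j, w) (Id - Ps(w)).  The bounded
    solution of x(n+1) = A(th^n w) x(n) + f(n+1) is

      x(n) = sum_(j >= 0) S(j, th^(n-j) w) f(n-j)
             - sum_(j >= 1) U(j, th^(n+j) w) f(n+j).

    Both kinds of weight contain e^(-phi(n)) for a rate phi with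
    phi(k) <= phi(n) + b |k - n| and b = |beta| < alpha: phi(n) = beta n in (i)
    and phi(n) = beta |n| in (ii).  The bounds of the dichotomy and the norm
    of f multiply to e^(phi(n)) e^(-(alpha - b) j) for the terms at distance j
    from n, the bound K being cancelled exactly by the weight on f.  So both
    parts of the theorem have the same proof and the same constant
    gamma = 2 / (1 - e^(b - alpha)): the two series are dominated by a
    geometric one ([green_solution_bound]), and shifting them by one step gives
    the equation ([green_solutionP]).

    Uniqueness ([green_homogeneous]): if y solves the homogeneous equation then
    Ps y(n) = S(j, th^(n-j) w) y(n-j) for all j, of norm at most a constant
    times K(th^(n-j) w) e^(-(alpha - b) j).  This tends to 0 because K is
    subexponential along a tempered orbit; symmetrically for Id - Ps, looking
    forward in time.

    Measurability: each term of the series is a strongly measurable family of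
    continuous maps applied to a measurable function, which is measurable when
    X is separable ([measurable_borel_caratheodory]); limits of measurable
    maps are measurable ([measurable_borel_cvg]).

    Finally, temperedness at a point says that |ln K(th^k w)| <= c + e |k| for
    every e > 0 and some c ([tempered_atP]).  In this form it is visibly
    invariant under th and a countable combination of measurable conditions. *)

Set Implicit Arguments.
Unset Strict Implicit.
Unset Printing Implicit Defensive.

Import Order.TTheory GRing.Theory Num.Theory.
Import numFieldNormedType.Exports.

Local Open Scope classical_set_scope.
Local Open Scope ring_scope.

(** * Measurable maps into a normed space *)

Section borel_valued_maps.
Context (R : realType) (X : normedModType R).

(** Pointwise limits only control values up to an error, so membership in an
    open set has to be tested on smaller open sets that stay at a positive
    distance from its complement. *)
Lemma open_uniform_exhaustion (U : set X) : open U ->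
  exists V : nat -> set X, [/\ forall k, open (V k),
    forall x, U x -> exists k, V k x &
    forall k, exists2 e : R, 0 < e & forall x y, V k x -> `|x - y| < e -> U y].
Proof.
move=> oU.
pose W k := [set x : X | forall y, `|x - y| < k.+1%:R^-1 -> U y].
exists (fun k => (W k)°); split.
- by move=> k; exact: open_interior.
- move=> x Ux.
  have /nbhs_ballP[e /= e0 eU] : nbhs x U by exact: open_nbhs_nbhs.
  have [k _ kP] := near_infty_natSinv_lt (PosNum (divr_gt0 e0 (ltr0n R 2))).
  exists k; apply/nbhs_ballP; exists (e / 2) => [|z] /=; first exact: divr_gt0.
  rewrite -ball_normE /= => xz y zy; apply: eU; rewrite -ball_normE /=.
  have /= k2 : k.+1%:R^-1 < e / 2 by apply: kP (leqnn k).
  rewrite (le_lt_trans (ler_distD z _ _)) // [ltRHS]splitr ltrD //.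
  exact: lt_trans k2.
- move=> k; exists k.+1%:R^-1; first by rewrite invr_gt0.
  by move=> x y /interior_subset; apply.
Qed.

Context d (T : measurableType d) (D : set T).

Lemma measurable_borel (f : T -> X) :
  (measurable D -> forall U : set X, open U -> measurable (D `&` f @^-1` U)) ->
  measurable_fun D (f : T -> borel X).
Proof.
move=> h mD.
by apply: (@measurability _ _ T (borel X) D f (@open X)) => // _ [U oU <-]; exact: h.
Qed.

Lemma measurable_borel_preimage (f : T -> X) (U : set X) : measurable D ->
  measurable_fun D (f : T -> borel X) -> open U -> measurable (D `&` f @^-1` U).
Proof. by move=> mD mf oU; apply: mf => //; exact: sub_sigma_algebra. Qed.

(** The limit lies in U exactly when, for some k, the sequence is eventually in
    the k-th set of a uniform exhaustion of U. *)
Lemma measurable_borel_cvg (h : nat -> T -> X) (f : T -> X) :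
  (forall n, measurable_fun D (h n : T -> borel X)) ->
  (forall w, D w -> h ^~ w @ \oo --> f w) ->
  measurable_fun D (f : T -> borel X).
Proof.
move=> mh hf; apply: measurable_borel => mD U oU.
have [V [oV UV VU]] := open_uniform_exhaustion oU.
rewrite (_ : _ `&` _ = \bigcup_k \bigcup_N \bigcap_(n in [set n | (N <= n)%N])
    (D `&` h n @^-1` V k)); last first.
  apply/seteqP; split => [w [Dw Uw]|w [k _ [N _ hN]]].
    have [k Vk] := UV _ Uw.
    have [N _ hN] : \forall n \near \oo, V k (h n w).
      by apply: (hf w Dw); exact: open_nbhs_nbhs.
    by exists k => //; exists N => // n /= Nn; split => //; exact: hN.
  have Dw : D w by have [] := hN N (leqnn N).
  split => //=; have [e e0 eU] := VU k.
  have [M _ hM] : \forall n \near \oo, `|f w - h n w| < e.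
    by have /cvgrPdist_lt := hf w Dw; apply.
  apply: (eU (h (maxn N M) w)); first by apply: (hN _ _).2; exact: leq_maxl.
  by rewrite distrC; apply: hM; exact: leq_maxr.
apply: bigcup_measurable => k _; apply: bigcup_measurable => N _.
apply: bigcap_measurable; first by exists N => /=.
by move=> n _; exact: measurable_borel_preimage.
Qed.

Lemma measurable_borel_comp (Y : normedModType R) (g : X -> Y) (f : T -> X) :
  continuous g -> measurable_fun D (f : T -> borel X) ->
  measurable_fun D (g \o f : T -> borel Y).
Proof.
move=> cg mf mD.
apply: (@measurability _ _ T (borel Y) D (g \o f) (@open Y)) => // _ [U oU <-].
rewrite comp_preimage; apply: measurable_borel_preimage => //.
by move/continuousP: cg; apply.
Qed.

End borel_valued_maps.

Section separable_target.
Context (R : realType) (X : normedModType R).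
Hypothesis sepX : separable X.

Lemma separable_sequence :
  exists s : nat -> X, forall x e, 0 < e -> exists i, `|x - s i| < e.
Proof.
have [S /countable_injP[g ginj] dS] := sepX.
exists (fun i => xget 0 [set x | S x /\ g x = i]) => x e e0.
have [] := dS (ball x e); first by exists x; exact: ballxx.
  exact: ball_open.
move=> y [xy Sy]; exists (g y); case: xgetP => [z _ [Sz gz]|/(_ y)]; last by case.
by have <- : y = z; [apply: ginj; rewrite ?inE | move: xy; rewrite -ball_normE].
Qed.

Context d (T : measurableType d) (D : set T).

(** By continuity, F w (f w) is in U exactly when, for some k and m, F w sends
    every point s i of a dense sequence with |f w - s i| < 1/(m+1) into the k-th
    set of a uniform exhaustion of U: only countably many of the measurable
    maps F ^~ x are involved. *)
Lemma measurable_borel_caratheodory (Y : normedModType R) (F : T -> X -> Y) (f : T -> X) :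
  (forall w, D w -> continuous (F w)) ->
  (forall x, measurable_fun D (fun w => F w x : borel Y)) ->
  measurable_fun D (f : T -> borel X) ->
  measurable_fun D (fun w => F w (f w) : borel Y).
Proof.
move=> cF mF mf; apply: measurable_borel => mD U oU.
have [s sP] := separable_sequence.
have [V [oV UV VU]] := open_uniform_exhaustion oU.
rewrite (_ : _ `&` _ = \bigcup_k \bigcup_m \bigcap_i
    ((D `\` (D `&` f @^-1` ball (s i) m.+1%:R^-1)) `|`
     (D `&` (F ^~ (s i)) @^-1` V k))); last first.
  apply/seteqP; split => [w [Dw Uw]|w [k _ [m _ hm]]].
    have [k Vk] := UV _ Uw.
    have /nbhs_ballP[e /= e0 eV] : nbhs (f w) (F w @^-1` V k).
      by apply: (cF w Dw); exact: open_nbhs_nbhs.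
    have [m _ mP] := near_infty_natSinv_lt (PosNum e0).
    exists k => //; exists m => // i _.
    have [fs|fs] := pselect (ball (s i) m.+1%:R^-1 (f w)); last first.
      by left; split => // -[].
    right; split => //; apply: eV; apply: ball_sym.
    by apply: le_ball fs; apply/ltW/(mP m (leqnn m)).
  have Dw : D w by have [[]|[]] := hm 0%N I.
  split => //=; have [e e0 eU] := VU k.
  have /nbhs_ballP[r /= r0 rV] : nbhs (f w) (F w @^-1` ball (F w (f w)) e).
    by apply: (cF w Dw); exact: nbhsx_ballx.
  have m0 : 0 < m.+1%:R^-1 :> R by rewrite invr_gt0.
  have [i] := sP (f w) (Num.min r m.+1%:R^-1) (ltac:(by rewrite lt_min r0 m0)).
  rewrite lt_min => /andP[ir im].
  have [[_ ]|[_ /= Vi]] := hm i I.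
    by case; split => //=; rewrite -ball_normE /= distrC.
  apply: (eU _ _ Vi); rewrite distrC.
  by have /(_ (s i)) := rV; rewrite -!ball_normE /=; apply.
apply: bigcup_measurable => k _; apply: bigcup_measurable => m _.
apply: bigcapT_measurable => i; apply: measurableU.
  apply: measurableD => //; apply: measurable_borel_preimage => //.
  exact: ball_open.
exact: measurable_borel_preimage.
Qed.

(** Continuity of the addition on X * X would only help after identifying the
    Borel sigma-algebra of X * X with the product one.  Fixing one summand makes
    the addition a Caratheodory map, which avoids this. *)
Lemma measurable_borelD (f g : T -> X) :
  measurable_fun D (f : T -> borel X) -> measurable_fun D (g : T -> borel X) ->
  measurable_fun D (fun w => f w + g w : borel X).
Proof.
move=> mf mg; apply: (@measurable_borel_caratheodory _ (fun w x => f w + x)) => //.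
  by move=> w _ x; apply: cvgD; [exact: cvg_cst|exact: cvg_id].
move=> x; apply: (@measurable_borel_comp _ _ _ _ _ X (fun y => y + x)) => // y.
by apply: cvgD; [exact: cvg_id|exact: cvg_cst].
Qed.

End separable_target.

(** * Series in a Banach space *)

Section series_lemmas.
Context (R : realType) (X : completeNormedModType R).
Implicit Types a : nat -> X.

Lemma geometric_majorant_cvg a (C q : R) : 0 <= C -> 0 <= q < 1 ->
  (forall j, `|a j| <= C * q ^+ j) ->
  cvgn (series a) /\ `|limn (series a)| <= C / (1 - q).
Proof.
move=> C0 /andP[q0 q1] aC.
have nq : `|q| < 1 by rewrite ger0_norm.
have cg := is_cvg_geometric_series (a := C) nq.
have cn : cvgn [normed series a].
  apply: series_le_cvg cg => [n|n|n]; [exact: normr_ge0| |exact: aC].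
  by rewrite /= mulr_ge0 ?exprn_ge0.
split; first exact: normed_cvg.
rewrite (le_trans (lim_series_norm cn)) // -(cvg_lim _ (cvg_geometric_series (a := C) nq)) //.
exact: lim_series_le.
Qed.

Lemma cvg_series_linear (L : {linear X -> X}) a : continuous L ->
  cvgn (series a) -> series (L \o a) @ \oo --> L (limn (series a)).
Proof.
move=> cL ca; rewrite (_ : series _ = L \o series a).
  exact: continuous_cvg (cL _) ca.
by apply/funext => n; rewrite /series /= linear_sum.
Qed.

Lemma lim_series_recl a : cvgn (series (fun j => a j.+1)) ->
  limn (series a) = a 0%N + limn (series (fun j => a j.+1)).
Proof.
move=> ca; apply: cvg_lim => //; rewrite -cvg_shiftS.
have -> : [sequence series a n.+1]_n = (fun n => a 0%N + series (fun j => a j.+1) n).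
  by apply/funext => n; rewrite /series /= big_nat_recl.
by apply: cvgD => //; exact: cvg_cst.
Qed.

End series_lemmas.

(** * Bounded solutions from a Green function on the integers *)

Section green.
Context (R : realType) (X : completeNormedModType R).

(** The dichotomy seen from a single orbit, as a nonautonomous equation on the
    integers with steps [L k] from time k to k + 1.  [Gs j k] carries the stable
    component from time k to k + j and [Gu j k] carries the unstable one back
    from time k to k - j; each is related to [L] applied after it and before
    it. *)
Record green_pair (L : int -> {linear X -> X}) (Gs Gu : nat -> int -> X -> X)
    (kappa : int -> R) (a : R) : Prop := GreenPair {
  green_continuous : forall k, continuous (L k);
  green0 : forall k x, Gs 0%N k x + Gu 0%N k x = x;
  green_s_post : forall k j x, L (k + j%:Z) (Gs j k x) = Gs j.+1 k x;
  green_s_pre : forall k j x, Gs j (k + 1) (L k x) = Gs j.+1 k x;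
  green_u_post : forall k j x, L (k - j.+1%:Z) (Gu j.+1 k x) = Gu j k x;
  green_u_pre : forall k j x, Gu j.+1 (k + 1) (L k x) = Gu j k x;
  green_s_bound : forall k j x,
    `|Gs j k x| <= kappa k * expR (- (a * j%:R)) * `|x|;
  green_u_bound : forall k j x,
    `|Gu j k x| <= kappa k * expR (- (a * j%:R)) * `|x| }.

(** Common to the rates c n and c |n|, with b = |c|; see [slow_rate_linear] and
    [slow_rate_abs]. *)
Definition slow_rate (phi : int -> R) (b : R) : Prop :=
  forall k n, phi k <= phi n + b * `|k - n|%:~R.

Definition green_solution (Gs Gu : nat -> int -> X -> X) (f : int -> X) (n : int) : X :=
  limn (series (fun j => Gs j (n - j%:Z) (f (n - j%:Z)))) -
  limn (series (fun j => Gu j.+1 (n + j.+1%:Z) (f (n + j.+1%:Z)))).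

Context (L : int -> {linear X -> X}) (Gs Gu : nat -> int -> X -> X)
  (kappa : int -> R) (a b : R) (phi : int -> R).
Hypotheses (kappa0 : forall k, 0 < kappa k) (ba : b < a) (phib : slow_rate phi b).
Hypothesis (G : green_pair L Gs Gu kappa a).

Let q := expR (b - a).

Let q01 : 0 <= q < 1.
Proof. by rewrite expR_ge0 expR_lt1 subr_lt0. Qed.

(** The factor [kappa] of the operator bound is cancelled by the one in the
    weight on [x], and moving the rate from k to n costs b |k - n| = b j, which
    the decay e^(- a j) absorbs. *)
Lemma green_term (T : X -> X) (x : X) (M : R) (k n : int) (j : nat) :
  `|T x| <= kappa k * expR (- (a * j%:R)) * `|x| ->
  kappa k * expR (- phi k) * `|x| <= M -> `|k - n| = j%:Z ->
  `|T x| <= M * expR (phi n) * q ^+ j.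
Proof.
move=> Tx xM kn; apply: le_trans Tx _.
have M0 : 0 <= M by apply: le_trans xM; rewrite !mulr_ge0 ?expR_ge0 // ltW.
have -> : kappa k * expR (- (a * j%:R)) * `|x| =
    kappa k * expR (- phi k) * `|x| * (expR (phi k) * expR (- (a * j%:R))).
  by rewrite [expR (- phi k)]expRN; field; rewrite gt_eqF ?expR_gt0.
apply: le_trans (ler_wpM2r _ xM) _; first by rewrite mulr_ge0 ?expR_ge0 ?M0.
rewrite -mulrA ler_wpM2l // -expRM_natr -!expRD ler_expR.
have := phib k n; rewrite kn; change (j%:Z%:~R) with (j%:R : R); lra.
Qed.

Section solution.
Context (f : int -> X) (M : R).
Hypothesis fM : forall k, kappa k * expR (- phi k) * `|f k| <= M.

Let M0 : 0 <= M.
Proof. by apply: le_trans (fM 0); rewrite !mulr_ge0 ?expR_ge0 // ltW. Qed.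

Lemma green_s_series n :
  cvgn (series (fun j => Gs j (n - j%:Z) (f (n - j%:Z)))) /\
  `|limn (series (fun j => Gs j (n - j%:Z) (f (n - j%:Z))))|
    <= M * expR (phi n) / (1 - q).
Proof.
apply: geometric_majorant_cvg => //; first by rewrite mulr_ge0 ?expR_ge0 ?M0.
move=> j; apply: green_term (green_s_bound G _ _ _) (fM _) _; lia.
Qed.

Lemma green_u_series n :
  cvgn (series (fun j => Gu j.+1 (n + j.+1%:Z) (f (n + j.+1%:Z)))) /\
  `|limn (series (fun j => Gu j.+1 (n + j.+1%:Z) (f (n + j.+1%:Z))))|
    <= M * expR (phi n) / (1 - q).
Proof.
apply: geometric_majorant_cvg => //; first by rewrite mulr_ge0 ?expR_ge0 ?M0.
(* this series starts at distance 1; the extra factor q <= 1 is dropped *)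
move=> j; have [q0 q1] := andP q01.
apply: (@le_trans _ _ (M * expR (phi n) * q ^+ j.+1)).
  apply: green_term (green_u_bound G _ _ _) (fM _) _; lia.
by rewrite ler_wpM2l ?mulr_ge0 ?expR_ge0 // ler_wiXn2l // ltW.
Qed.

(** Applying [L n] prolongs each stable term by one step and shortens each
    unstable one.  What is then missing in the stable series at n + 1 and
    superfluous in the unstable one are the two terms at distance 0, and those
    add up to f (n + 1). *)
Lemma green_solutionP (n : int) :
  green_solution Gs Gu f (n + 1) = L n (green_solution Gs Gu f n) + f (n + 1).
Proof.
rewrite /green_solution linearB.
have sn := (green_s_series n).1; have un := (green_u_series n).1.
have Ls := cvg_series_linear (green_continuous G (k := n)) sn.
have Lu := cvg_series_linear (green_continuous G (k := n)) un.
have Es : L n \o (fun j => Gs j (n - j%:Z) (f (n - j%:Z))) =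
    (fun j => Gs j.+1 (n + 1 - j.+1%:Z) (f (n + 1 - j.+1%:Z))).
  apply/funext => j /=; rewrite -(green_s_post G).
  have -> : n + 1 - j.+1%:Z = n - j%:Z by lia.
  by rewrite subrK.
have Eu : L n \o (fun j => Gu j.+1 (n + j.+1%:Z) (f (n + j.+1%:Z))) =
    (fun j => Gu j (n + 1 + j%:Z) (f (n + 1 + j%:Z))).
  apply/funext => j /=; rewrite -[RHS](green_u_post G).
  have -> : n + 1 + j%:Z = n + j.+1%:Z by lia.
  by rewrite addrK.
rewrite Es in Ls; rewrite Eu in Lu.
rewrite -(cvg_lim _ Lu) // [X in X - _ = _]lim_series_recl; last exact/cvgP/Ls.
rewrite (cvg_lim _ Ls) // [limn (series (fun j => Gu j _ _))]lim_series_recl; last first.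
  exact: (green_u_series (n + 1)).1.
have -> : n + 1 - 0%:Z = n + 1 by lia.
have e := green0 G (n + 1) (f (n + 1)).
set g0 := Gs 0%N _ _ in e *; set g1 := L n _; set g2 := Gu 0%N _ _ in e *.
rewrite -{}e opprD (addrA g1) [RHS]addrC [RHS]addrA [in RHS]addrACA subrr addr0 //.
Qed.

Lemma green_solution_bound n :
  expR (- phi n) * `|green_solution Gs Gu f n| <= 2 / (1 - q) * M.
Proof.
rewrite mulrC expRN ler_pdivrMr ?expR_gt0 //.
apply: le_trans (ler_normB _ _) _.
apply: le_trans (lerD (green_s_series n).2 (green_u_series n).2) _.
lra.
Qed.

End solution.

Section uniqueness.
Context (y : int -> X) (C : R).
Hypothesis yL : forall n, y (n + 1) = L n (y n).
Hypothesis yC : forall n, expR (- phi n) * `|y n| <= C.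
Hypothesis kappa_slow :
  forall e : R, 0 < e -> exists c, forall k, kappa k <= c * expR (e * `|k|%:~R).

Lemma green_s_iter n j : Gs j (n - j%:Z) (y (n - j%:Z)) = Gs 0%N n (y n).
Proof.
elim: j => [|j <-]; first by rewrite subr0.
rewrite -(green_s_pre G) -yL.
by have -> : n - j.+1%:Z + 1 = n - j%:Z by lia.
Qed.

Lemma green_u_iter n j : Gu j (n + j%:Z) (y (n + j%:Z)) = Gu 0%N n (y n).
Proof.
elim: j => [|j <-]; first by rewrite addr0.
rewrite -[RHS](green_u_pre G) -yL.
by have -> : n + j%:Z + 1 = n + j.+1%:Z by lia.
Qed.

(** The reason for uniqueness in either time direction: z is carried from the
    point at distance j, where the growth of [kappa] and of the rate of y loses
    against e^(- a j). *)
Lemma green_vanish (T : nat -> X -> X) (k : nat -> int) (n : int) (z : X) :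
  (forall j, `|k j - n| = j%:Z) ->
  (forall j x, `|T j x| <= kappa (k j) * expR (- (a * j%:R)) * `|x|) ->
  (forall j, T j (y (k j)) = z) -> z = 0.
Proof.
move=> kn Tb Tz.
(* half of the gap is given to the growth of kappa, the other half decays *)
pose e := (a - b) / 2.
have e0 : 0 < e by rewrite divr_gt0 // subr_gt0.
have [c cP] := kappa_slow e0.
have zle j : `|z| <= c * expR (e * `|n|%:~R) * C * expR (phi n) * expR (- e) ^+ j.
  have c0 : 0 <= C by apply: le_trans (yC 0); rewrite mulr_ge0 ?expR_ge0.
  rewrite -(Tz j); apply: le_trans (Tb j _) _.
  have yk : `|y (k j)| <= C * expR (phi (k j)).
    by have := yC (k j); rewrite mulrC expRN ler_pdivrMr ?expR_gt0.
  have kj : kappa (k j) <= c * expR (e * (`|n|%:~R + j%:R)).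
    apply: le_trans (cP _) _.
    have cpos : 0 < c.
      have := lt_le_trans (kappa0 0) (cP 0).
      by rewrite pmulr_lgt0 // expR_gt0.
    rewrite ler_wpM2l ?(ltW cpos) // ler_expR ler_pM2l // -[j%:R]/(j%:Z%:~R) -intrD ler_int.
    have := kn j; lia.
  apply: le_trans (ler_pM _ _ (ler_wpM2r (expR_ge0 _) kj) yk) _ => //.
    by rewrite mulr_ge0 ?expR_ge0 // ltW.
  rewrite -expRM_natr.
  have -> : c * expR (e * (`|n|%:~R + j%:R)) * expR (- (a * j%:R)) * (C * expR (phi (k j)))
    = c * C * (expR (e * (`|n|%:~R + j%:R)) * expR (- (a * j%:R)) * expR (phi (k j))) by ring.
  have -> : c * expR (e * `|n|%:~R) * C * expR (phi n) * expR (- e * j%:R)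
    = c * C * (expR (e * `|n|%:~R) * expR (phi n) * expR (- e * j%:R)) by ring.
  rewrite -!expRD ler_wpM2l ?ler_expR ?mulr_ge0 //.
    by have := lt_le_trans (kappa0 0) (cP 0); rewrite pmulr_lgt0 ?expR_gt0 // => /ltW.
  have := phib (k j) n; rewrite kn; change (j%:Z%:~R) with (j%:R : R).
  rewrite /e; lra.
apply/eqP; rewrite -normr_eq0 eq_le normr_ge0 andbT.
have ne : `|expR (- e)| < 1 by rewrite ger0_norm ?expR_ge0 // expR_lt1 oppr_lt0.
have /(ler_cvg_to (cvg_cst `|z|)) :=
  @cvg_geometric _ (c * expR (e * `|n|%:~R) * C * expR (phi n)) _ ne.
by apply; exact: nearW zle.
Qed.

Lemma green_homogeneous n : y n = 0.
Proof.
rewrite -(green0 G n (y n)).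
rewrite (@green_vanish (fun j => Gs j (n - j%:Z)) (fun j => n - j%:Z) n (Gs 0%N n (y n))).
- rewrite (@green_vanish (fun j => Gu j (n + j%:Z)) (fun j => n + j%:Z) n (Gu 0%N n (y n))).
  + by rewrite addr0.
  + lia.
  + by move=> j x; exact: green_u_bound G _ _ _.
  + exact: green_u_iter.
- lia.
- by move=> j x; exact: green_s_bound G _ _ _.
- exact: green_s_iter.
Qed.

End uniqueness.

End green.

(** * Orbits and temperedness *)

Section sublinear.
Context (R : realType).

(** A bound on all terms, uniform in n thanks to the additive constant, replaces
    the limit; unlike the limit it is obviously stable under shifts. *)
Lemma cvg_ratio0P (l : nat -> R) (s : nat -> R) : (forall n, `|s n| = n%:R) ->
  (fun n => l n / s n) @ \oo --> (0 : R) <->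
  forall e : R, 0 < e -> exists c, forall n, `|l n| <= c + e * n%:R.
Proof.
move=> sn; split => [l0 e e0|h].
  have /cvgr0Pnorm_le/(_ _ e0)[N _ hN] := l0.
  exists (\sum_(0 <= i < N.+1) `|l i|) => n.
  have [nN|Nn] := leqP n N.
    apply: (@le_trans _ _ (\sum_(0 <= i < N.+1) `|l i|)).
      by rewrite (bigD1_seq n) ?iota_uniq ?mem_index_iota //= lerDl sumr_ge0.
    by rewrite lerDl mulr_ge0 // ltW.
  have n0 : 0 < n%:R :> R by rewrite ltr0n (leq_trans _ Nn).
  have := hN n (ltnW Nn); rewrite normrM normfV sn ler_pdivrMr // => /le_trans; apply.
  by rewrite lerDr sumr_ge0.
apply/cvgr0Pnorm_le => e e0.
have [c cP] := h (e / 2) (divr_gt0 e0 (ltr0n R 2)).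
near=> n.
have n0 : 0 < n%:R :> R by near: n; exists 1%N => // m /= m0; rewrite ltr0n.
rewrite normrM normfV sn ler_pdivrMr // (le_trans (cP n)) //.
suff : c * (2 / e) <= n%:R by rewrite -ler_pdivlMr ?divr_gt0 // invf_div; lra.
near: n; exact: nbhs_infty_ger.
Unshelve. all: by end_near. Qed.

End sublinear.

Section orbits.
Context (R : realType) d (Omega : measurableType d).
Context (P : {measure set Omega -> \bar R}) (th thi : Omega -> Omega).
Hypothesis TH : invertible_mpt P th thi.

Lemma iterZS (n : int) w : iterZ th thi (n + 1) w = th (iterZ th thi n w).
Proof.
case: n => n; first by have -> : n%:Z + 1 = n.+1%:Z by lia.
case: n => [|n].
  have -> : Negz 0 + 1 = 0%:Z by lia.
  by rewrite /= (mpt_invK TH).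
have -> : Negz n.+1 + 1 = Negz n by lia.
by rewrite /= (mpt_invK TH).
Qed.

Lemma iterZB1 (n : int) w : iterZ th thi (n - 1) w = thi (iterZ th thi n w).
Proof. by rewrite -[in RHS](subrK 1 n) iterZS (mpt_K TH). Qed.

Lemma iterZ_iter (n : int) j w :
  iter j th (iterZ th thi n w) = iterZ th thi (n + j%:Z) w.
Proof.
elim: j => [|j IH]; first by rewrite addr0.
by rewrite /= IH -iterZS; congr iterZ; lia.
Qed.

Lemma iterZ_iterV (n : int) j w :
  iter j thi (iterZ th thi n w) = iterZ th thi (n - j%:Z) w.
Proof.
elim: j => [|j IH]; first by rewrite subr0.
by rewrite /= IH -iterZB1; congr iterZ; lia.
Qed.

Lemma iterZ_th (n : int) w : iterZ th thi n (th w) = iterZ th thi (n + 1) w.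
Proof.
case: n => n.
  have -> : n%:Z + 1 = n.+1%:Z by lia.
  by rewrite /iterZ iterSr.
rewrite {1}/iterZ iterSr (mpt_K TH).
case: n => [|n]; first by have -> : Negz 0 + 1 = 0%:Z by lia.
by have -> : Negz n.+1 + 1 = Negz n by lia.
Qed.

Lemma iterZ_meas n : measurable_fun setT (iterZ th thi n).
Proof.
case: n => n /=; elim: n => [|n IH] //=.
- exact: measurable_id.
- exact: measurableT_comp (mpt_meas TH) IH.
- exact: measurableT_comp (mpt_inv_meas TH) _.
- exact: measurableT_comp (mpt_inv_meas TH) IH.
Qed.

Lemma invariant_set_th (D : set Omega) w : invariant_set th D -> D (th w) <-> D w.
Proof.
move=> iD; split => [|Dw]; last by rewrite -iD; exists w.
by rewrite -[X in X (th w)]iD => -[v Dv /(can_inj (mpt_K TH)) <-].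
Qed.

Lemma invariant_setP (D : set Omega) : (forall w, D (th w) <-> D w) -> invariant_set th D.
Proof.
move=> h; apply/seteqP; split => [_ [w /h Dw <-]//|w Dw].
by exists (thi w); [apply/h; rewrite (mpt_invK TH)|exact: mpt_invK TH _].
Qed.

Lemma invariant_set_iterZ (D : set Omega) n w : invariant_set th D ->
  D w -> D (iterZ th thi n w).
Proof.
move=> iD Dw; case: n => n /=.
  by elim: n => //= n IH; exact/(invariant_set_th _ iD).
have inv v : D v -> D (thi v).
  by move=> Dv; apply/(invariant_set_th _ iD); rewrite (mpt_invK TH).
by apply: (inv _); elim: n => //= n IH; exact: (inv _ IH).
Qed.

Variable K : Omega -> R.

Lemma tempered_atP w : tempered_at th thi K w <->
  forall e : R, 0 < e -> exists c, forall k : int,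
    `|ln (K (iterZ th thi k w))| <= c + e * `|k|%:~R.
Proof.
rewrite /tempered_at cvg_ratio0P ?cvg_ratio0P; first last.
- by move=> n; rewrite normr_nat.
- by move=> n; rewrite intrN normrN normr_nat.
split => [[hp hn] e e0|h].
  have [c1 c1P] := hp e e0; have [c2 c2P] := hn e e0.
  exists (Num.max c1 c2) => -[] n.
    by rewrite (le_trans (c1P n)) // lerD2r le_max lexx.
  have := c2P n.+1; rewrite (_ : - n.+1%:Z = Negz n); last by lia.
  move=> /le_trans; apply; rewrite (_ : `|Negz n| = n.+1%:Z); last by lia.
  by rewrite lerD2r le_max lexx orbT.
split => e /h[c cP]; exists c => n; first exact: (cP n%:Z).
by have := cP (- n%:Z); rewrite normrN.
Qed.

Lemma tempered_at_th w : tempered_at th thi K (th w) <-> tempered_at th thi K w.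
Proof.
rewrite !tempered_atP; split => h e e0; have [c cP] := h e e0; exists (c + e) => k.
  have := cP (k - 1); rewrite iterZ_th subrK => /le_trans; apply.
  rewrite -addrA lerD2l -[X in _ <= X + _]mulr1 -mulrDr ler_pM2l // -(intrD _ 1) ler_int.
  lia.
rewrite iterZ_th; have /le_trans := cP (k + 1); apply.
rewrite -addrA lerD2l -[X in _ <= X + _]mulr1 -mulrDr ler_pM2l // -(intrD _ 1) ler_int.
lia.
Qed.

Lemma tempered_growth w e : (forall v, 0 < K v) -> tempered_at th thi K w -> 0 < e ->
  exists c, forall k : int, K (iterZ th thi k w) <= c * expR (e * `|k|%:~R).
Proof.
move=> K0 /tempered_atP h e0; have [c cP] := h e e0; exists (expR c) => k.
rewrite -expRD -[leLHS]lnK ?posrE // ler_expR; exact: le_trans (ler_norm _) (cP k).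
Qed.

(** With e = 1/(m+1) and c a natural number, [tempered_atP] only has countable
    quantifiers. *)
Lemma measurable_tempered_at : measurable_fun setT K ->
  measurable [set w | tempered_at th thi K w].
Proof.
move=> mK.
have mln k : measurable_fun setT (fun w => `|ln (K (iterZ th thi k w))|).
  apply: measurableT_comp => //; apply: measurableT_comp; first exact: measurable_ln.
  by apply: measurableT_comp mK _; exact: iterZ_meas.
rewrite (_ : [set _ | _] = \bigcap_m \bigcup_c \bigcap_k
   [set w | `|ln (K (iterZ th thi k w))| <= c%:R + m.+1%:R^-1 * `|k|%:~R]); last first.
  apply/seteqP; split => w /=.
    move=> /tempered_atP h m _; have [c cP] := h m.+1%:R^-1 (ltac:(by rewrite invr_gt0)).
    exists (Num.truncn c).+1 => // k _ /=; rewrite (le_trans (cP k)) // lerD2r.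
    exact/ltW/truncnS_gt.
  move=> h; apply/tempered_atP => e e0.
  have [m _ mP] := near_infty_natSinv_lt (PosNum e0).
  have [c _ cP] := h m I; exists c%:R => k.
  rewrite (le_trans (cP k I)) // lerD2l ler_wpM2r ?ler0z //.
  exact/ltW/(mP m (leqnn m)).
apply: bigcapT_measurable => m; apply: bigcup_measurable => c _.
rewrite -[X in measurable X]setCK setC_bigcap; apply: measurableC.
apply: countable_bigcupT_measurable => [|k]; first exact: countableP.
apply: measurableC.
rewrite -[X in measurable X]setTI.
exact: (@measurable_fun_le _ _ _ setT _ (cst (c%:R + m.+1%:R^-1 * `|k|%:~R)) _ (mln k) _).
Qed.

Lemma tempered_partP D : measurable D -> invariant_set th D -> full_measure P D ->
  tempered P th thi K ->
  [/\ measurable (tempered_part th thi D K), invariant_set th (tempered_part th thi D K)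
    & full_measure P (tempered_part th thi D K)].
Proof.
move=> mD iD fD [[mK _] tK].
have mT := measurable_tempered_at mK.
have mDT : measurable (tempered_part th thi D K) by exact: measurableI.
split => //.
  by apply: invariant_setP => w; rewrite /tempered_part /= (invariant_set_th _ iD) tempered_at_th.
apply/negligibleP; first exact: measurableC.
rewrite /tempered_part setCI; apply: negligibleU => //.
by apply/negligibleP => //; exact: measurableC.
Qed.

End orbits.

(** * Operator norms and weighted norms *)

Section norms.
Context (R : realType) (X : completeNormedModType R).

Lemma opnorm_le (T : X -> X) (C : R) (x : X) :
  (forall c z, T (c *: z) = c *: T z) -> (opnorm T <= C%:E)%E ->
  `|T x| <= C * `|x|.
Proof.
move=> TZ TC; have [->|x0] := eqVneq x 0.
  by rewrite -(scale0r (0 : X)) TZ !scale0r normr0 mulr0.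
have nx : 0 < `|x| by rewrite normr_gt0.
have : `|T (`|x|^-1 *: x)| <= C.
  rewrite -lee_fin; apply: le_trans TC; apply: ereal_sup_ubound.
  exists (`|x|^-1 *: x) => //=.
  by rewrite normrZ normfV normr_id mulVf // gt_eqF.
by rewrite TZ normrZ normfV normr_id mulrC ler_pdivrMr.
Qed.

Lemma wnorm_le (W : int -> R) (f : int -> X) (M : R) :
  (wnorm W f <= M%:E)%E <-> forall n, W n * `|f n| <= M.
Proof.
split => [h n|h]; last by apply: ge_ereal_sup => _ [n _ <-]; rewrite lee_fin.
by rewrite -lee_fin; apply: le_trans h; apply: ereal_sup_ubound; exists n.
Qed.

Lemma linf_bound (W : int -> R) (f : int -> X) : (forall n, 0 <= W n) -> linf W f ->
  exists2 M, wnorm W f = M%:E & forall n, W n * `|f n| <= M.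
Proof.
move=> W0 lf.
have : (0 <= wnorm W f)%E.
  apply: (@le_trans _ _ (W 0 * `|f 0|)%:E); first by rewrite lee_fin mulr_ge0.
  by apply: ereal_sup_ubound; exists 0.
move: lf; rewrite /linf /=; case E : (wnorm W f) => [M| |] // _ _.
by exists M => //; apply/wnorm_le; rewrite E.
Qed.

Lemma linf_le (W : int -> R) (f : int -> X) (M : R) :
  (forall n, W n * `|f n| <= M) -> linf W f.
Proof. by move/wnorm_le => h; rewrite /linf /= (le_lt_trans h) // ltry. Qed.

End norms.

(** * The Green function of a dichotomy *)

Section dichotomy_green.
Context (R : realType) (X : completeNormedModType R).
Context d (Omega : measurableType d).
Context (P : {measure set Omega -> \bar R}) (th thi : Omega -> Omega).
Context (Phi : nat -> Omega -> {linear X -> X}) (Ps : Omega -> {linear X -> X}).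
Context (D : set Omega) (alpha K : Omega -> R).
Hypotheses (TH : invertible_mpt P th thi) (CO : measurable_cocycle th Phi).
Hypothesis (iD : invariant_set th D).
Hypothesis (DI : dichotomy_with P th thi Phi Ps D alpha K).

Local Notation unst w := (range (compl_proj Ps w)).
Local Notation pt := (iterZ th thi).

Definition Gstable (j : nat) (w : Omega) (x : X) : X := Phi j w (Ps w x).
Definition Gunstable (j : nat) (w : Omega) (x : X) : X :=
  cocycle_inv thi Phi Ps j w (compl_proj Ps w x).

Lemma unstP w v : D w -> unst w v <-> Ps w v = 0.
Proof.
move=> Dw; split => [[x _ <-]|Pv]; last by exists v => //; rewrite /compl_proj Pv subr0.
by rewrite /compl_proj linearB /= (dich_proj DI Dw) subrr.
Qed.

Lemma compl_proj_unst w x : unst w (compl_proj Ps w x). Proof. by exists x. Qed.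

Lemma iter_thiK m w : iter m th (iter m thi w) = w.
Proof. by elim: m w => // m IH w; rewrite iterS iterSr IH (mpt_invK TH). Qed.

Lemma D_th w : D w -> D (th w).
Proof. by move=> Dw; apply/(invariant_set_th TH _ iD). Qed.

Lemma D_iter_thi m w : D w -> D (iter m thi w).
Proof.
move=> Dw; rewrite -[w]/(pt 0 w) (iterZ_iterV TH).
exact: (invariant_set_iterZ TH).
Qed.

Lemma GunstableP m w x : D w ->
  Ps (iter m thi w) (Gunstable m w x) = 0 /\
  Phi m (iter m thi w) (Gunstable m w x) = compl_proj Ps w x.
Proof.
move=> Dw; have Dw' := D_iter_thi m Dw.
have [_ inj surj] := dich_iso_bij DI Dw' m; rewrite iter_thiK in surj.
have [v uv vE] := surj _ (compl_proj_unst w x).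
rewrite /Gunstable /cocycle_inv -vE pinvKV ?inE //.
by split => //; exact/(unstP _ Dw').
Qed.

(** The inverse branch is handled only through this characterization, by
    injectivity of Phi(m) on the unstable range. *)
Lemma Gunstable_unique m w x v : D w -> Ps (iter m thi w) v = 0 ->
  Phi m (iter m thi w) v = compl_proj Ps w x -> Gunstable m w x = v.
Proof.
move=> Dw Pv vE; have Dw' := D_iter_thi m Dw.
have [Pg gE] := GunstableP m x Dw.
have [_ inj _] := dich_iso_bij DI Dw' m.
by apply: inj; rewrite ?inE ?gE ?vE //; exact/unstP.
Qed.

Lemma GunstableZ m w c x : D w -> Gunstable m w (c *: x) = c *: Gunstable m w x.
Proof.
move=> Dw; have [Pg gE] := GunstableP m x Dw; apply: Gunstable_unique => //.
  by rewrite linearZ /= Pg scaler0.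
by rewrite linearZ /= gE /compl_proj linearZ /= scalerBr.
Qed.

Lemma GunstableB m w x y : D w ->
  Gunstable m w (x - y) = Gunstable m w x - Gunstable m w y.
Proof.
move=> Dw; have [Px xE] := GunstableP m x Dw; have [Py yE] := GunstableP m y Dw.
apply: Gunstable_unique => //; first by rewrite linearB /= Px Py subrr.
rewrite linearB /= xE yE /compl_proj (linearB (Ps w)) /= !opprB addrACA [RHS]addrACA.
by rewrite (addrC (- y)).
Qed.

Lemma Gstable_bound j w x : D w ->
  `|Gstable j w x| <= K w * expR (- (alpha w * j%:R)) * `|x|.
Proof.
move=> Dw; apply: (@opnorm_le _ _ (Phi j w \o Ps w)); last exact: (dich_stable DI).
by move=> c z /=; rewrite !linearZ.
Qed.

Lemma Gunstable_bound j w x : D w ->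
  `|Gunstable j w x| <= K w * expR (- (alpha w * j%:R)) * `|x|.
Proof.
move=> Dw; apply: (@opnorm_le _ _ (Gunstable j w)); first by move=> c z; exact: GunstableZ.
by rewrite -mulrN; exact: (dich_unstable DI).
Qed.

Lemma Gstable_continuous j w : D w -> continuous (Gstable j w).
Proof.
by move=> Dw x; apply: continuous_comp;
  [exact: (dich_continuous DI)|exact: (cocycle_continuous CO)].
Qed.

Lemma Gunstable_continuous j w : D w -> continuous (Gunstable j w).
Proof.
move=> Dw x; apply/cvgrPdist_lt => e e0.
pose C := `|K w * expR (- (alpha w * j%:R))| + 1.
have C0 : 0 < C by rewrite ltr_wpDl.
near=> y; rewrite -GunstableB //.
apply: le_lt_trans (Gunstable_bound _ _ Dw) _.
apply: (@le_lt_trans _ _ (C * `|x - y|)).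
  by rewrite ler_wpM2r // (le_trans (ler_norm _)) // lerDl.
rewrite mulrC -ltr_pdivlMr //.
by near: y; apply: cvgr_dist_lt; rewrite ?divr_gt0.
Unshelve. all: by end_near. Qed.

Lemma Gstable_post j w x : Phi 1%N (iter j th w) (Gstable j w x) = Gstable j.+1 w x.
Proof. by rewrite /Gstable -(cocycleD CO) addn1. Qed.

Lemma Gstable_pre j w x : D w -> Gstable j (th w) (Phi 1%N w x) = Gstable j.+1 w x.
Proof.
by move=> Dw; rewrite /Gstable (dich_comm DI Dw 1%N) -[th w]/(iter 1 th w) -(cocycleD CO).
Qed.

Lemma Gunstable_post j w x : D w ->
  Phi 1%N (iter j.+1 thi w) (Gunstable j.+1 w x) = Gunstable j w x.
Proof.
move=> Dw; have [Pv vE] := GunstableP j.+1 x Dw.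
have w'E : iter 1 th (iter j.+1 thi w) = iter j thi w by rewrite /= (mpt_invK TH).
apply/esym/Gunstable_unique => //.
  by rewrite -w'E (dich_comm DI (D_iter_thi _ Dw)) Pv linear0.
by rewrite -w'E -(cocycleD CO).
Qed.

Lemma Gunstable_pre j w x : D w -> Gunstable j.+1 (th w) (Phi 1%N w x) = Gunstable j w x.
Proof.
move=> Dw; have [Pv vE] := GunstableP j x Dw.
have w'E : iter j.+1 thi (th w) = iter j thi w by rewrite iterSr (mpt_K TH).
apply: Gunstable_unique; rewrite ?w'E //; first exact: D_th.
rewrite -addn1 (cocycleD CO) vE iter_thiK /compl_proj linearB.
by rewrite -[th w]/(iter 1 th w) (dich_comm DI Dw).
Qed.

Lemma dichotomy_green_pair w : D w ->
  green_pair (fun n => Phi 1%N (pt n w)) (fun j n => Gstable j (pt n w))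
    (fun j n => Gunstable j (pt n w)) (fun n => K (pt n w)) (alpha w).
Proof.
move=> Dw.
have Dn n : D (pt n w) by exact: (invariant_set_iterZ TH).
have an n : alpha (pt n w) = alpha w.
  have ia : invariant_set th [set v | alpha v = alpha w].
    by apply: (invariant_setP TH) => v /=; rewrite (dich_exponent DI).2.
  exact: (invariant_set_iterZ TH n ia).
split.
- by move=> k; exact: (cocycle_continuous CO).
- move=> k x; rewrite /Gstable (cocycle0 CO).
  rewrite (@Gunstable_unique 0 _ x (compl_proj Ps (pt k w) x)) //=.
  + by rewrite /compl_proj addrC subrK.
  + exact/(unstP _ (Dn k))/compl_proj_unst.
  + by rewrite (cocycle0 CO).
- by move=> k j x; rewrite -(iterZ_iter TH) Gstable_post.
- by move=> k j x; rewrite (iterZS TH) Gstable_pre.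
- by move=> k j x; rewrite -(iterZ_iterV TH) Gunstable_post.
- by move=> k j x; rewrite (iterZS TH) Gunstable_pre.
- by move=> k j x; rewrite -(an k); exact: Gstable_bound.
- by move=> k j x; rewrite -(an k); exact: Gunstable_bound.
Qed.

End dichotomy_green.

(** * Admissibility for a slow rate *)

Section admissibility.
Context (R : realType) (X : completeNormedModType R).
Context d (Omega : measurableType d).
Context (P : {measure set Omega -> \bar R}) (th thi : Omega -> Omega).
Context (Phi : nat -> Omega -> {linear X -> X}) (Ps : Omega -> {linear X -> X}).
Context (D E : set Omega) (alpha K b : Omega -> R).
Hypotheses (sepX : separable X).
Hypotheses (TH : invertible_mpt P th thi) (CO : measurable_cocycle th Phi).
Hypotheses (mD : measurable D) (iD : invariant_set th D).
Hypothesis (DI : dichotomy_with P th thi Phi Ps D alpha K).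
Hypotheses (ED : E `<=` D) (tE : forall w, E w -> tempered_at th thi K w).
Hypotheses (mb : measurable_fun setT b) (ib : invariant_fun th b).
Hypothesis ba : forall w, b w < alpha w.

Local Notation pt := (iterZ th thi).
Local Notation A := (fun w => Phi 1%N w : X -> X).

Definition dichotomy_solution (w : Omega) (f : int -> X) : int -> X :=
  green_solution (fun j n => Gstable Phi Ps j (pt n w))
    (fun j n => Gunstable thi Phi Ps j (pt n w)) f.

(** Sum of the two geometric series of ratio e^(b - alpha) that dominate the
    stable and the unstable part, both taken from distance 0 on. *)
Definition gain (w : Omega) : R := 2 / (1 - expR (b w - alpha w)).

Lemma gain_gt0 w : 0 < gain w.
Proof. by rewrite divr_gt0 // subr_gt0 expR_lt1 subr_lt0. Qed.

Lemma gain_rv : positive_rv gain /\ invariant_fun th gain.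
Proof.
have [[ma _] ia] := dich_exponent DI.
split; last by move=> w; rewrite /gain ib ia.
split; last exact: gain_gt0.
(* inversion is measurable as a real power *)
have -> : gain = (fun w => 2 * (1 - expR (b w - alpha w)) `^ (-1)).
  by apply/funext => w; rewrite /gain powR_inv1 // subr_ge0 expR_le1 subr_le0 ltW.
apply: (measurable_funM (f := cst 2)) => //.
apply: (measurableT_comp (measurable_powR (-1))).
apply: measurable_funB => //; apply: measurableT_comp => //.
exact: measurable_funB.
Qed.

Lemma measurable_Gstable j (k : int) x :
  measurable_fun E (fun w => Gstable Phi Ps j (pt k w) x : borel X).
Proof.
have mS : measurable_fun D (fun w => Gstable Phi Ps j w x : borel X).
  apply: (measurable_borel_caratheodory sepX (F := fun w => Phi j w)).
  - by move=> w _; exact: (cocycle_continuous CO).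
  - by move=> y; apply: measurable_funS (cocycle_meas CO j y).
  - exact: dich_meas DI x.
apply: (measurable_comp mD _ mS).
  by move=> _ [w Ew <-]; apply: (invariant_set_iterZ TH _ iD); exact: ED.
by apply: measurable_funS (iterZ_meas TH k).
Qed.

Lemma measurable_Gunstable j (k : int) x :
  measurable_fun E (fun w => Gunstable thi Phi Ps j (pt k w) x : borel X).
Proof.
apply: (measurable_comp mD _ (dich_inv_meas DI j x)).
  by move=> _ [w Ew <-]; apply: (invariant_set_iterZ TH _ iD); exact: ED.
by apply: measurable_funS (iterZ_meas TH k).
Qed.

Lemma measurable_borel_series (a : nat -> Omega -> X) :
  (forall j, measurable_fun E (a j : _ -> borel X)) ->
  (forall w, E w -> cvgn (series (a ^~ w))) ->
  measurable_fun E (fun w => limn (series (a ^~ w)) : borel X).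
Proof.
move=> ma ca; apply: (measurable_borel_cvg (h := fun n w => series (a ^~ w) n)) => //.
elim=> [|n IH].
  rewrite (_ : (fun w => _) = cst (0 : borel X)); first exact: measurable_cst.
  by apply/funext => w; rewrite /series /= big_nil.
rewrite (_ : (fun w => _) = (fun w => series (a ^~ w) n + a n w)).
  exact: measurable_borelD.
by apply/funext => w; rewrite seriesSr.
Qed.

Section rate.
Variable phi : Omega -> int -> R.
Hypothesis phib : forall w, slow_rate (phi w) (b w).

Let W (k : Omega -> R) w n := k (pt n w) * expR (- phi w n).

Let K0 w : 0 < K w. Proof. exact: (dich_bound DI).1.2. Qed.

Let GP w (Ew : E w) := dichotomy_green_pair TH CO iD DI (ED Ew).

Let W_ge0 w n : 0 <= W K w n.
Proof. by rewrite /W mulr_ge0 ?expR_ge0 // ltW. Qed.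

Lemma dichotomy_solutionP w f : E w -> linf (W K w) f ->
  [/\ linf (W (cst 1%R) w) (dichotomy_solution w f),
      solution th thi A w f (dichotomy_solution w f) &
      (wnorm (W (cst 1%R) w) (dichotomy_solution w f) <= (gain w)%:E * wnorm (W K w) f)%E].
Proof.
move=> Ew /(linf_bound (W_ge0 w)) [M ME fM].
have bnd n : W (cst 1%R) w n * `|dichotomy_solution w f n| <= gain w * M.
  rewrite /W /cst mul1r.
  exact: (green_solution_bound (fun k => K0 _) (ba w) (phib w) (GP Ew) fM).
split; first exact: linf_le bnd.
- by move=> n; exact: (green_solutionP (fun k => K0 _) (ba w) (phib w) (GP Ew) fM).
- by rewrite ME -EFinM; apply/wnorm_le.
Qed.

Lemma solution_unique w f x y : E w ->
  linf (W (cst 1%R) w) x -> solution th thi A w f x ->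
  linf (W (cst 1%R) w) y -> solution th thi A w f y -> x = y.
Proof.
have W1 n : 0 <= W (cst 1%R) w n by rewrite /W mulr_ge0 ?expR_ge0 // ler01.
move=> Ew /(linf_bound W1)[Mx _ xM] sx /(linf_bound W1)[My _ yM] sy.
apply/funext => n; apply/eqP; rewrite -subr_eq0; apply/eqP.
have hom k : x (k + 1) - y (k + 1) = Phi 1%N (pt k w) (x k - y k).
  by rewrite sx sy linearB /= opprD addrACA subrr addr0.
apply: (green_homogeneous (fun k => K0 _) (ba w) (phib w) (GP Ew)
  (y := fun k => x k - y k) (C := Mx + My)) => //.
  move=> k; apply: (le_trans _ (lerD (xM k) (yM k))).
  by rewrite /W /cst !mul1r -mulrDr ler_wpM2l ?expR_ge0 // ler_normB.
by move=> e e0; exact: tempered_growth (tE Ew) e0.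
Qed.

Lemma measurable_solution f : linf_on E (W K) f -> measurable_sections E f ->
  measurable_sections E (fun w => dichotomy_solution w (f w)).
Proof.
move=> lf mf n.
have fM w : E w -> exists M, forall k, W K w k * `|f w k| <= M.
  by move=> Ew; have [M _ fM] := linf_bound (W_ge0 w) (lf w Ew); exists M.
rewrite /dichotomy_solution /green_solution.
apply: (measurable_borelD sepX (g := fun w => - limn _)).
  apply: (measurable_borel_series (a := fun j w =>
    Gstable Phi Ps j (pt (n - j%:Z) w) (f w (n - j%:Z)))).
    move=> j; apply: (measurable_borel_caratheodory sepX
      (F := fun w => Gstable Phi Ps j (pt (n - j%:Z) w))) => //.
      move=> w Ew; apply: (Gstable_continuous CO DI).
      by apply: (invariant_set_iterZ TH _ iD); exact: ED.
    by move=> x; exact: measurable_Gstable.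
  move=> w Ew; have [M wM] := fM w Ew.
  exact: (green_s_series (fun k => K0 _) (ba w) (phib w) (GP Ew) wM n).1.
apply: (measurable_borel_comp (g := @GRing.opp X)).
  by move=> x; apply: cvgN; exact: cvg_id.
apply: (measurable_borel_series (a := fun j w =>
  Gunstable thi Phi Ps j.+1 (pt (n + j.+1%:Z) w) (f w (n + j.+1%:Z)))).
  move=> j; apply: (measurable_borel_caratheodory sepX
    (F := fun w => Gunstable thi Phi Ps j.+1 (pt (n + j.+1%:Z) w))) => //.
    move=> w Ew; apply: (Gunstable_continuous TH iD DI).
    by apply: (invariant_set_iterZ TH _ iD); exact: ED.
  by move=> x; exact: measurable_Gunstable.
move=> w Ew; have [M wM] := fM w Ew.
exact: (green_u_series (fun k => K0 _) (ba w) (phib w) (GP Ew) wM n).1.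
Qed.

(** Both parts of the theorem at once, for an arbitrary rate. *)
Lemma admissible_rate :
  measurably_properly_admissible th thi A E (linf_on E (W K)) (linf_on E (W (cst 1%R))) /\
  (exists gamma : Omega -> R,
    [/\ positive_rv gamma, invariant_fun th gamma &
      forall (w : Omega) (f : int -> X), E w -> linf (W K w) f ->
        exists x : int -> X,
          unique (fun y => linf (W (cst 1%R) w) y /\ solution th thi A w f y) x /\
          (wnorm (W (cst 1%R) w) x <= (gamma w)%:E * wnorm (W K w) f)%E]).
Proof.
split; first split.
- move=> f lf; exists (fun w => dichotomy_solution w (f w)).
  split; [| |move=> y ly sy w Ew].
  + by move=> w Ew; have [] := dichotomy_solutionP Ew (lf w Ew).
  + by move=> w Ew; have [] := dichotomy_solutionP Ew (lf w Ew).
  + have [lx sx _] := dichotomy_solutionP Ew (lf w Ew).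
    exact: solution_unique Ew (ly w Ew) (sy w Ew) lx sx.
- move=> f x lf mf lx sx n.
  apply: eq_measurable_fun (measurable_solution lf mf n) => w; rewrite inE => Ew.
  have [lx' sx' _] := dichotomy_solutionP Ew (lf w Ew).
  by rewrite (solution_unique Ew lx' sx' (lx w Ew) (sx w Ew)).
- have [pg ig] := gain_rv; exists gain; split => // w f Ew lf.
  have [lx sx nx] := dichotomy_solutionP Ew lf.
  exists (dichotomy_solution w f); split => //; split => // y [ly sy].
  exact: solution_unique Ew lx sx ly sy.
Qed.

End rate.
End admissibility.

Lemma slow_rate_linear (R : realType) (c : R) :
  slow_rate (fun n => c * n%:~R) `|c|.
Proof.
move=> k n; rewrite -lerBlDl -mulrBr -intrB.
by rewrite (le_trans (ler_norm _)) // normrM intr_norm.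
Qed.

Lemma slow_rate_abs (R : realType) (c : R) :
  slow_rate (fun n => c * `|n|%:~R) `|c|.
Proof.
move=> k n; rewrite -lerBlDl -mulrBr -intrB.
rewrite (le_trans (ler_norm _)) // normrM ler_wpM2l // -intr_norm ler_int.
lia.
Qed.

Theorem theorem1 (R : realType) (X : completeNormedModType R)
    (d : measure_display) (Omega : measurableType d)
    (P : {measure set Omega -> \bar R}) (th thi : Omega -> Omega)
    (Phi : nat -> Omega -> {linear X -> X})
    (D : set Omega) (alpha K beta : Omega -> R) :
  separable X ->
  invertible_mpt P th thi ->
  measurable_cocycle th Phi ->
  tempered_dichotomy P th thi Phi D alpha K ->
  measurable_fun setT beta ->
  invariant_fun th beta ->
  (forall w, - alpha w < beta w < alpha w) ->
  let A : Omega -> X -> X := fun w => Phi 1%N w in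
  let D' := tempered_part th thi D K in
  [/\ [/\ measurable D', invariant_set th D' & full_measure P D'],
      measurably_properly_admissible th thi A D'
        (linf_on D' (weight th thi K beta))
        (linf_on D' (weight th thi (cst 1%R) beta)) /\
      (exists gamma : Omega -> R,
        [/\ positive_rv gamma, invariant_fun th gamma &
          forall (w : Omega) (f : int -> X), D' w ->
            linf (weight th thi K beta w) f ->
            exists x : int -> X,
              unique (fun y => linf (weight th thi (cst 1%R) beta w) y /\
                               solution th thi A w f y) x /\
              (wnorm (weight th thi (cst 1%R) beta w) x
                 <= (gamma w)%:E * wnorm (weight th thi K beta w) f)%E]) &
      measurably_properly_admissible th thi A D'
        (linf_on D' (weight_abs th thi K beta))
        (linf_on D' (weight_abs th thi (cst 1%R) beta)) /\
      (exists gamma : Omega -> R,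
        [/\ positive_rv gamma, invariant_fun th gamma &
          forall (w : Omega) (f : int -> X), D' w ->
            linf (weight_abs th thi K beta w) f ->
            exists x : int -> X,
              unique (fun y => linf (weight_abs th thi (cst 1%R) beta w) y /\
                               solution th thi A w f y) x /\
              (wnorm (weight_abs th thi (cst 1%R) beta w) x
                 <= (gamma w)%:E * wnorm (weight_abs th thi K beta w) f)%E])].
Proof.
move=> sepX TH CO [mD iD fD [Ps DI]] mbeta ibeta ab A D'.
have [mD' iD' fD'] := tempered_partP TH mD iD fD (dich_bound DI).
have D'D : D' `<=` D by move=> w [].
have tD' w : D' w -> tempered_at th thi K w by case.
have mb : measurable_fun setT (fun w => `|beta w|) by exact: measurableT_comp.
have ib : invariant_fun th (fun w => `|beta w|) by move=> w; rewrite ibeta.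
have ba w : `|beta w| < alpha w by rewrite ltr_norml.
split => //.
- have h := admissible_rate sepX TH CO mD iD DI D'D tD' mb ib ba
    (phi := fun w n => beta w * n%:~R) (fun w => slow_rate_linear (beta w)).
  exact: h.
- have h := admissible_rate sepX TH CO mD iD DI D'D tD' mb ib ba
    (phi := fun w n => beta w * `|n|%:~R) (fun w => slow_rate_abs (beta w)).
  exact: h.
Qed.
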